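(* Let $\sigma=12\cdots(a-1)(a+1)a(a+2)(a+3)\cdots m$ where $m\geq5$ and $2\leq a\leq m-2$, let $i=\min(a,m-a)$, $u=4t/(1+t)^{2}$ and $z=(1+t)x/(1-t)$. Then (a) \[ \frac{1}{1-t}+\frac{1+t}{2(1-t)}\sum_{n=1}^{\infty}P_{\sigma,n}^{\mathrm{ipk}}(s,u)z^{n}=\sum_{n=0}^{\infty}\Bigg(\frac{2tx}{(1-t)^{2}}+\frac{(1+t)(s-1)u^{2}z^{m}}{2(1-t)(1-(s-1)u\sum_{l=1}^{i}z^{m-l})}\Bigg)^{*\langle n\rangle} \] and (b) \[ \frac{1}{1-t}+\frac{1+t}{2(1-t)}\sum_{n=1}^{\infty}P_{\sigma,n}^{\mathrm{ipk}}(u)z^{n}=\sum_{n=0}^{\infty}\Bigg(\frac{2tx}{(1-t)^{2}}-\frac{(1+t)u^{2}z^{m}}{2(1-t)(1+u\sum_{l=1}^{i}z^{m-l})}\Bigg)^{*\langle n\rangle}. \]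
   Context: $\mathfrak{S}_n$ is the set of permutations of $[n]$ in one-line notation. The pattern $\sigma\in\mathfrak{S}_m$ is obtained from $12\cdots m$ by swapping the adjacent letters $a$ and $a+1$. $\operatorname{std}$ of a sequence of distinct integers replaces its letters by $1,2,\dots$ in order of size. For $\pi\in\mathfrak{S}_n$, $\operatorname{occ}_\sigma(\pi)$ is the number of $j\in[n-m+1]$ with $\operatorname{std}(\pi_j\cdots\pi_{j+m-1})=\sigma$. A peak of $\pi$ is $j\in\{2,\dots,n-1\}$ with $\pi_{j-1}<\pi_j>\pi_{j+1}$; $\operatorname{pk}$ counts peaks and $\operatorname{ipk}(\pi)=\operatorname{pk}(\pi^{-1})$. $P_{\sigma,n}^{\mathrm{ipk}}(s,t)=\sum_{\pi\in\mathfrak{S}_n}s^{\operatorname{occ}_\sigma(\pi)}t^{\operatorname{ipk}(\pi)+1}$ for $n\ge1$, and $P_{\sigma,n}^{\mathrm{ipk}}(t)=P_{\sigma,n}^{\mathrm{ipk}}(0,t)$. The right sides are computed in formal power series with ordinary multiplication in $s,x$ and the Hadamard product in $t$: $(\sum_n a_nt^n)*(\sum_n b_nt^n)=\sum_n a_nb_nt^n$; $f^{*\langle n\rangle}$ is the $n$-fold Hadamard product, $f^{*\langle0\rangle}=1/(1-t)$. Other expressions use ordinary multiplication. *)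

(* Defs.v *)
From HB Require Import structures.
From mathcomp Require Import all_boot all_order all_fingroup all_algebra.
From mathcomp Require Import boolp.

Set Implicit Arguments.
Unset Strict Implicit.
Unset Printing Implicit Defensive.

Import GRing.Theory.
Local Open Scope ring_scope.

(* [f n] is the coefficient of the n-th power of the variable. *)
Record fps (R : Type) := FPS { fps_coef :> nat -> R }.

Lemma fpsP (R : Type) (f g : fps R) : (forall n, f n = g n) -> f = g.
Proof. by case: f g => f [g] /= fg; congr FPS; apply/funext. Qed.

HB.instance Definition _ (R : Type) := gen_eqMixin (fps R).
HB.instance Definition _ (R : Type) := gen_choiceMixin (fps R).

Section FpsZmodule.
Variable R : zmodType.
Implicit Types f g h : fps R.

Definition fps_zero : fps R := FPS (fun=> 0).
Definition fps_opp f : fps R := FPS (fun n => - f n).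
Definition fps_add f g : fps R := FPS (fun n => f n + g n).

Fact fps_addA : associative fps_add.
Proof. by move=> f g h; apply: fpsP => n /=; rewrite addrA. Qed.
Fact fps_addC : commutative fps_add.
Proof. by move=> f g; apply: fpsP => n /=; rewrite addrC. Qed.
Fact fps_add0 : left_id fps_zero fps_add.
Proof. by move=> f; apply: fpsP => n /=; rewrite add0r. Qed.
Fact fps_addN : left_inverse fps_zero fps_opp fps_add.
Proof. by move=> f; apply: fpsP => n /=; rewrite addNr. Qed.

HB.instance Definition _ :=
  GRing.isZmodule.Build (fps R) fps_addA fps_addC fps_add0 fps_addN.

Lemma fps_coef0 n : (0 : fps R) n = 0. Proof. by []. Qed.
Lemma fps_coefN f n : (- f) n = - f n. Proof. by []. Qed.
Lemma fps_coefD f g n : (f + g) n = f n + g n. Proof. by []. Qed.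

End FpsZmodule.

Section FpsComRing.
Variable R : comNzRingType.
Implicit Types f g h : fps R.

Definition fpsC (c : R) : fps R := FPS (fun n => if n is 0 then c else 0).
Definition fpsX : fps R := FPS (fun n => (n == 1)%:R).

Definition fps_mul f g : fps R :=
  FPS (fun n => \sum_(i < n.+1) f i * g (n - i)%N).

Let trunc N f : {poly R} := \poly_(i < N) f i.

Fact fps_mul_trunc f g N n : (n < N)%N ->
  fps_mul f g n = (trunc N f * trunc N g)`_n.
Proof.
move=> ltnN; rewrite coefM /=; apply: eq_bigr => i _.
rewrite !coef_poly (leq_ltn_trans _ ltnN) ?leq_ord //.
by rewrite (leq_ltn_trans (leq_subr _ _) ltnN).
Qed.

Fact fps_mulC : commutative fps_mul.
Proof.
by move=> f g; apply: fpsP => n; rewrite !(@fps_mul_trunc _ _ n.+1) // mulrC.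
Qed.

Fact fps_mulA : associative fps_mul.
Proof.
move=> f g h; apply: fpsP => n.
have truncM p q k : (k <= n)%N ->
    (trunc n.+1 (fps_mul p q))`_k = (trunc n.+1 p * trunc n.+1 q)`_k.
  by move=> le_kn; rewrite coef_poly ltnS le_kn (@fps_mul_trunc _ _ n.+1).
rewrite !(@fps_mul_trunc _ _ n.+1) //.
transitivity (trunc n.+1 f * (trunc n.+1 g * trunc n.+1 h))`_n.
  by rewrite 2!coefM; apply: eq_bigr => i _; rewrite truncM ?leq_subr.
rewrite mulrA 2!coefM; apply: eq_bigr => i _.
by rewrite truncM // -ltnS ltn_ord.
Qed.

Fact fps_mul1 : left_id (fpsC 1) fps_mul.
Proof.
move=> f; apply: fpsP => n /=.
by rewrite big_ord_recl /= mul1r subn0 big1 ?addr0 // => i _; rewrite mul0r.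
Qed.

Fact fps_mulDl : left_distributive fps_mul +%R.
Proof.
move=> f g h; apply: fpsP => n /=; rewrite -[RHS]big_split /=.
by apply: eq_bigr => i _; rewrite mulrDl.
Qed.

Fact fps_one_neq0 : fpsC 1 != 0.
Proof.
apply/eqP => /(congr1 (fun f : fps R => f 0%N)) /= /eqP.
by rewrite oner_eq0.
Qed.

HB.instance Definition _ := GRing.Zmodule_isComNzRing.Build (fps R)
  fps_mulA fps_mulC fps_mul1 fps_mulDl fps_one_neq0.

Lemma fps_coef1 n : (1 : fps R) n = if n is 0 then 1 else 0.
Proof. by []. Qed.
Lemma fps_coefM f g n : (f * g) n = \sum_(i < n.+1) f i * g (n - i)%N.
Proof. by []. Qed.

End FpsComRing.

Section FpsUnitRing.
Variable R : comUnitRingType.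
Implicit Types f g : fps R.

(* The first n coefficients of 1 / f, from the recurrence
   \sum_(i <= k) b_i * f_(k - i) = [k = 0]. *)
Fixpoint fps_inv_prefix f (n : nat) : seq R :=
  if n is k.+1 then
    let b := fps_inv_prefix f k in
    rcons b (((k == 0)%:R - \sum_(i < k) b`_i * f (k - i)%N) / f 0%N)
  else [::].

Definition fps_unit : {pred fps R} := fun f => f 0%N \is a GRing.unit.

(* Following the library convention, a non-unit is its own inverse. *)
Definition fps_inv f : fps R :=
  if f 0%N \is a GRing.unit then FPS (fun n => (fps_inv_prefix f n.+1)`_n)
  else f.

Fact size_fps_inv_prefix f n : size (fps_inv_prefix f n) = n.
Proof. by elim: n => //= n IHn; rewrite size_rcons IHn. Qed.

Fact nth_fps_inv_prefix f n i : (i < n)%N ->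
  (fps_inv_prefix f n)`_i = (fps_inv_prefix f i.+1)`_i.
Proof.
elim: n => // n IHn; rewrite ltnS leq_eqVlt => /predU1P[-> // | lt_in].
rewrite -(IHn lt_in) /= nth_rcons size_fps_inv_prefix.
by rewrite lt_in.
Qed.

Fact fps_mulVx : {in fps_unit, left_inverse 1 fps_inv *%R}.
Proof.
move=> f Uf; rewrite /fps_inv [f 0%N \is a _]Uf; apply: fpsP => n.
rewrite fps_coefM fps_coef1 big_ord_recr /= subnn.
rewrite nth_rcons size_fps_inv_prefix ltnn eqxx divrK //.
under eq_bigr => i _ do rewrite -[rcons _ _]/(fps_inv_prefix f i.+1)
  -(@nth_fps_inv_prefix f n) ?ltn_ord //.
by rewrite addrC subrK; case: n.
Qed.

Fact fps_unitPl f g : g * f = 1 -> fps_unit f.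
Proof.
move/(congr1 (fun h : fps R => h 0%N)).
rewrite fps_coefM big_ord1 fps_coef1 => gf1.
by apply/unitrP; exists (g 0%N); split; rewrite // mulrC.
Qed.

Fact fps_invr_out : {in [predC fps_unit], fps_inv =1 id}.
Proof. by move=> f /negPf nUf; rewrite /fps_inv [f 0%N \is a _]nUf. Qed.

HB.instance Definition _ := GRing.ComNzRing_hasMulInverse.Build (fps R)
  fps_mulVx fps_unitPl fps_invr_out.

Lemma fps_unitE f : (f \is a GRing.unit) = (f 0%N \is a GRing.unit).
Proof. by []. Qed.

End FpsUnitRing.

Section Hadamard.
Variable R : comUnitRingType.

Definition hadamard (f g : fps R) : fps R := FPS (fun n => f n * g n).

Definition hadamard_exp (f : fps R) (n : nat) : fps R :=
  iter n (hadamard f) (1 / (1 - fpsX R)).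

End Hadamard.

(* Coefficientwise convergence of \sum_n F n, the coefficients themselves
   being discrete. *)
Definition is_fps_sum (K : zmodType) (F : nat -> fps (fps K))
    (S : fps (fps K)) : Prop :=
  forall j k : nat, exists N : nat, forall M : nat, (N <= M)%N ->
    (\sum_(n < M) F n) j k = S j k.

(* Words are sequences of naturals, with positions counted from 0 and the
   letters of a permutation of [n] being 1, ..., n. *)

Definition one_line (n : nat) (p : 'S_n) : seq nat :=
  [seq (val (p i)).+1 | i <- enum 'I_n].

Definition std (w : seq nat) : seq nat :=
  [seq (count (fun y => y < x)%N w).+1 | x <- w].

Definition occ (sg : seq nat) (n : nat) (p : 'S_n) : nat :=
  count (fun j => std (take (size sg) (drop j (one_line p))) == sg)
        (iota 0 (n.+1 - size sg)).

Definition pk (n : nat) (p : 'S_n) : nat :=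
  let w := nth 0%N (one_line p) in
  count (fun j => (w j.-1 < w j) && (w j.+1 < w j))%N (iota 1 (n - 2)).

Definition ipk (n : nat) (p : 'S_n) : nat := pk (p^-1)%g.

Definition P_ipk (R : comNzRingType) (sg : seq nat) (n : nat) (s t : R) : R :=
  \sum_(p : 'S_n) s ^+ occ sg p * t ^+ (ipk p).+1.

(* 1 2 ... (a-1) (a+1) a (a+2) ... m *)
Definition swap_pattern (m a : nat) : seq nat :=
  iota 1 a.-1 ++ [:: a.+1; a] ++ iota a.+2 (m - a.+1).

(* Main.v *)
(* Write [rho = (1 + t) / (1 - t)].  The coefficient of [t ^ j] in
   [rho ^ (n + 1) * u ^ (ipk pi + 1) / 2] is the number of words of length [n]
   over the [2 * j] letters [0 < 1 < ... < 2 * j - 1] whose standardization is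
   [pi], where equal odd letters are ranked from left to right and equal even
   letters from right to left (these are Stembridge's enriched P-partitions,
   odd letters being the positive ones).  Hence the coefficient of [t ^ j] on
   the left is the generating function [A j] of words by occurrences of [sigma],
   and on the right it is the geometric series of [F j], the coefficient of
   [t ^ j] in the series raised to Hadamard powers, so that everything reduces to
   the Goulden-Jackson equation [A j = 1 + F j * A j].  Consecutive marked occurrences in a cluster overlap in
   [l <= min (a, m - a)] letters, and the overlaps [l] determine the whole cluster:
   it is an involution, a product of disjoint adjacent transpositions, one per
   occurrence, so that a cluster with [k] occurrences has exactly [k] peaks. *)

Require Import Defs.
From mathcomp Require Import all_boot all_order all_fingroup all_algebra zify ring.

Set Implicit Arguments.
Unset Strict Implicit.
Unset Printing Implicit Defensive.

Import GRing.Theory.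
Local Open Scope nat_scope.

(** * Words, the order on their positions, and chains *)

Definition letter_rel (asc : bool) (x y : nat) : bool :=
  (x < y) || ((x == y) && (odd x == asc)).

(** The test [p != q] makes the order strict: [letter_rel false] is reflexive on even letters. *)
Definition pos_lt (w : seq nat) (p q : nat) : bool :=
  letter_rel (p < q) (nth 0 w p) (nth 0 w q) && (p != q).

Lemma pos_lt_trans w : transitive (pos_lt w).
Proof.
move=> q p r; rewrite /pos_lt /letter_rel.
case: (ltngtP (nth 0 w p) (nth 0 w q)) => [lt_pq||eq_pq] //=.
  move=> _ /andP[/orP le_qr _].
  have lt_pr : nth 0 w p < nth 0 w r by case: le_qr => [|/andP[/eqP <-]] //; lia.
  by rewrite lt_pr; apply: contraTneq lt_pr => ->; rewrite ltnn.
rewrite eq_pq; case: (ltngtP (nth 0 w q) (nth 0 w r)) => //= [lt_qr _ _|eq_qr].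
  by apply: contraTneq lt_qr => <-; rewrite eq_pq ltnn.
by case: (odd _); lia.
Qed.

Lemma pos_lt_irr w p : pos_lt w p p = false.
Proof. by rewrite /pos_lt eqxx andbF. Qed.

Lemma pos_lt_total w p q : p != q -> ~~ pos_lt w p q -> pos_lt w q p.
Proof.
rewrite /pos_lt /letter_rel.
case: (ltngtP (nth 0 w p) (nth 0 w q)) => [||->] /=; lia.
Qed.

Lemma pos_lt_asym w p q : pos_lt w p q -> pos_lt w q p = false.
Proof.
by move=> pq; apply/negP => /(pos_lt_trans pq); rewrite pos_lt_irr.
Qed.

(** Here [f] lists positions by increasing rank; when [f] is the inverse of a permutation, the test
    says that this permutation is the standardization of [w]. *)
Definition sorts (n : nat) (f : nat -> nat) (w : seq nat) : bool :=
  all (fun r => pos_lt w (f r) (f r.+1)) (iota 0 n.-1).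

Lemma sortsP n f w :
  reflect (forall r, r.+1 < n -> pos_lt w (f r) (f r.+1)) (sorts n f w).
Proof.
apply: (iffP allP) => [H r ltr|H r]; first by apply: H; rewrite mem_iota; lia.
by rewrite mem_iota => ltr; apply: H; lia.
Qed.

Lemma sorts_lt n f w x y : sorts n f w -> x < y -> y < n -> pos_lt w (f x) (f y).
Proof.
move/sortsP=> H; elim: y => // y IHy; rewrite ltnS leq_eqVlt => /predU1P[-> /H //|].
by move=> ltxy ltyn; apply: pos_lt_trans (H _ ltyn); apply: IHy => //; lia.
Qed.

Fixpoint words (K n : nat) : seq (seq nat) :=
  if n is n'.+1 then [seq x :: w | x <- iota 0 K, w <- words K n'] else [:: [::]].

Lemma mem_words K n w :
  (w \in words K n) = (size w == n) && all (fun x => x < K) w.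
Proof.
elim: n w => [|n IHn] [|x w] //=; first by apply/negP => /allpairsP[[y v] []].
apply/allpairsP/idP => [[[y v] /= [yK vW [-> ->]]]|/and3P[sz xK wK]].
  by move: vW yK; rewrite IHn mem_iota eqSS => /andP[-> ->]; lia.
by exists (x, w); rewrite /= IHn mem_iota -eqSS sz wK; split => //; lia.
Qed.

Lemma uniq_words K n : uniq (words K n).
Proof.
elim: n => //= n IHn; rewrite allpairs_uniq ?iota_uniq //.
by move=> [x v] [y w] _ _ /= [-> ->].
Qed.

Lemma size_word K n w : w \in words K n -> size w = n.
Proof. by rewrite mem_words => /andP[/eqP]. Qed.

Lemma words_cat K k n :
  words K (k + n) = [seq u ++ v | u <- words K k, v <- words K n].
Proof.
elim: k => [|k IHk] /=; first by rewrite cats0 map_id.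
rewrite IHk; elim: (iota 0 K) => //= x xs ->.
by rewrite allpairs_cat allpairs_mapl map_allpairs.
Qed.

Lemma words_le K K' n : K' <= K ->
  perm_eq [seq w <- words K n | all (fun x => x < K') w] (words K' n).
Proof.
move=> le_K; apply: uniq_perm; rewrite ?filter_uniq ?uniq_words // => w.
rewrite mem_filter !mem_words; case: eqP => //=; rewrite ?andbF // => _.
case: (allP (s := w) (a := fun x => x < K')) => //= H.
by apply/allP => x /H; lia.
Qed.

(** A word read along its sorted positions: [d r] records whether the position increases at step
    [r], hence which parity of letter may be repeated there. *)
Definition chain (d : nat -> bool) (v : seq nat) : bool :=
  all (fun r => letter_rel (d r) (nth 0 v r) (nth 0 v r.+1)) (iota 0 (size v).-1).

Definition chains (d : nat -> bool) (K n : nat) : nat := count (chain d) (words K n).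

Lemma chain_rcons d x v c : chain d (rcons (x :: v) c) =
  chain d (x :: v) && letter_rel (d (size v)) (last x v) c.
Proof.
rewrite /chain size_rcons succnK [size _]/= -{1}[(size v).+1]addn1 iotaD all_cat.
rewrite /= andbT add0n; congr (_ && _).
  apply: eq_in_all => r; rewrite mem_iota => ltr.
  have [lt1 lt2] : r < size (x :: v) /\ r < size v by rewrite /=; lia.
  by rewrite nth_rcons lt2 -rcons_cons nth_rcons lt1.
rewrite nth_rcons ltnn eqxx -rcons_cons nth_rcons [X in if X then _ else _]leqnn.
by rewrite -[last x v]/(last 0 (x :: v)) -nth_last.
Qed.

Lemma chain_le_last d x v : chain d (x :: v) -> all (fun y => y <= last x v) (x :: v).
Proof.
elim/last_ind: v => [|v c IHv]; first by rewrite /= leqnn.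
rewrite -rcons_cons chain_rcons => /andP[/IHv /allP H rel].
rewrite all_rcons last_rcons leqnn; apply/allP => y /H.
by move: rel; rewrite /letter_rel; lia.
Qed.

(** Fix the last letter [c]. A chain is weakly increasing, so its last comparison bounds all earlier
    letters: they are below [c], or equal to [c] when its parity allows a repetition. *)
Lemma chains_S d K n :
  chains d K n.+2 = \sum_(c < K) chains d (c + (odd c == d n)) n.+1.
Proof.
rewrite -(big_mkord xpredT (fun c => chains d (c + (odd c == d n)) n.+1)).
rewrite /chains -[X in words K X]addn1 words_cat -sum1_count big_mkcond big_allpairs_dep.
rewrite exchange_big big_allpairs_dep /index_iota subn0.
apply: eq_big_seq => c; rewrite mem_iota => ltc; rewrite big_seq1.
have le_cK : c + (odd c == d n) <= K by case: (_ == _); lia.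
have := words_le n.+1 le_cK => /seq.permP <-.
rewrite count_filter -sum1_count [RHS]big_mkcond.
apply: eq_big_seq => v /size_word; case: v => // x v [sz].
rewrite cats1 chain_rcons sz.
rewrite /predI /=; case: (boolP (chain d (x :: v))) => //= /chain_le_last /allP le_last.
congr (if _ then _ else _); rewrite -[_ && all _ _]/(all _ (x :: v)).
apply/idP/allP => [rel y /le_last|/(_ _ (mem_last x v))]; rewrite /letter_rel.
  move: rel; rewrite /letter_rel; case: ltngtP => //= [lt_lc _|->] //; first by lia.
  by move=> /= ->; lia.
case: ltngtP => //=; case: eqP => /=; first by lia.
by lia.
Qed.


Lemma chains1 d K : chains d K 1 = K.
Proof.
rewrite /chains (@eq_in_count _ _ predT) => [|w /size_word]; last by case: w => [|x []].
by rewrite count_predT size_allpairs size_iota muln1.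
Qed.

Lemma chains_SK d K n :
  chains d K.+1 n.+2 = chains d K n.+2 + chains d (K + (odd K == d n)) n.+1.
Proof. by rewrite !chains_S big_ord_recr. Qed.

(** Reading the letters in the order [f] is an injection of the finite set of words into itself,
    hence a bijection, and turns sortedness into the chain condition. *)
Lemma count_sorts K n f : perm_eq (mkseq f n) (iota 0 n) ->
  count (sorts n f) (words K n) = chains (fun r => f r < f r.+1) K n.
Proof.
move=> permf; pose phi (w : seq nat) := mkseq (fun r => nth 0 w (f r)) n.
have f_lt r : r < n -> f r < n.
  by move=> ltrn; have := perm_mem permf (f r); rewrite map_f ?mem_iota //; lia.
have f_inj : {in gtn n &, injective f}.
  by apply/mkseq_uniqP; rewrite (perm_uniq permf) iota_uniq.
have f_onto k : k < n -> exists2 r, r < n & k = f r.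
  move=> ltkn; have := perm_mem permf k; rewrite mem_iota [RHS]ltkn.
  by case/mapP => r; rewrite mem_iota => ltrn ->; exists r => //; lia.
have phi_words : {subset map phi (words K n) <= words K n}.
  move=> v /mapP[w]; rewrite !mem_words => /andP[/eqP sz /allP wK] ->.
  rewrite size_mkseq eqxx; apply/allP => x /mapP[r]; rewrite mem_iota => ltr ->.
  by apply/wK/mem_nth; rewrite sz; apply: f_lt; lia.
have phi_uniq : uniq (map phi (words K n)).
  rewrite map_inj_in_uniq ?uniq_words // => v w /size_word szv /size_word szw eq_phi.
  apply: (@eq_from_nth _ 0) => [|k]; rewrite szv ?szw // => /f_onto[r ltrn ->].
  by have /(congr1 (nth 0 ^~ r)) := eq_phi; rewrite /phi !nth_mkseq.
have [] := uniq_min_size phi_uniq phi_words; first by rewrite size_map.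
move=> _ mem_phi; have /seq.permP count_phi := uniq_perm phi_uniq (uniq_words K n) mem_phi.
rewrite /chains -[RHS]count_phi count_map; apply: eq_in_count => w _.
rewrite /= /chain /sorts /phi size_mkseq.
apply: eq_in_all => r; rewrite mem_iota => ltr.
have [lt0 lt1] : r < n /\ r.+1 < n by lia.
rewrite /pos_lt !nth_mkseq // -[RHS]andbT; congr (_ && _).
by apply/eqP => /(f_inj _ _ lt0 lt1); lia.
Qed.

Local Open Scope ring_scope.

(** * Formal power series *)

Section SeriesCoefficients.

Variable R : comNzRingType.
Implicit Types f g : fps R.

Lemma coef_fpsXM f n : (fpsX R * f) n = if n is n'.+1 then f n' else 0.
Proof.
rewrite fps_coefM; case: n => [|n]; first by rewrite big_ord1 mul0r.
rewrite !big_ord_recl /= mul0r mul1r add0r subn1 big1 ?addr0 // => i _.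
by rewrite mul0r.
Qed.

Lemma coef_fpsCM c f n : (fpsC c * f) n = c * f n.
Proof.
by rewrite fps_coefM big_ord_recl /= subn0 big1 ?addr0 // => i _; rewrite mul0r.
Qed.

Lemma coef_fpsMn f k n : (f *+ k) n = f n *+ k.
Proof. by elim: k => // k IHk; rewrite !mulrS -IHk. Qed.

Lemma coef_fps_sum (I : Type) (r : seq I) (P : pred I) (F : I -> fps R) n :
  (\sum_(i <- r | P i) F i) n = \sum_(i <- r | P i) F i n.
Proof. by elim/big_rec2: _ => // i y1 y2 _ <-. Qed.

Lemma fpsCD (c d : R) : fpsC (c + d) = fpsC c + fpsC d.
Proof. by apply: fpsP => -[|n]; rewrite /= ?addr0. Qed.

Lemma fpsC0 : fpsC (0 : R) = 0.
Proof. by apply: fpsP => -[]. Qed.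

Lemma fpsCN (c : R) : fpsC (- c) = - fpsC c.
Proof. by apply: fpsP => -[|n]; rewrite /= ?oppr0. Qed.

Lemma fpsCM (c d : R) : fpsC (c * d) = fpsC c * fpsC d.
Proof. by apply: fpsP => n; rewrite coef_fpsCM; case: n => //= n; rewrite mulr0. Qed.

Lemma fpsCX (c : R) n : fpsC (c ^+ n) = fpsC c ^+ n.
Proof. by elim: n => // n IHn; rewrite !exprS fpsCM IHn. Qed.

Lemma coef_fpsXnM f k n : (fpsX R ^+ k * f) n = if (k <= n)%N then f (n - k)%N else 0.
Proof.
elim: k n => [|k IHk] [|n]; rewrite ?mul1r ?subn0 // exprS -mulrA coef_fpsXM //.
Qed.

End SeriesCoefficients.

Lemma unit_fps1BX (R : comUnitRingType) : 1 - fpsX R \is a GRing.unit.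
Proof. by rewrite fps_unitE fps_coefD fps_coefN subr0 unitr1. Qed.

Lemma unit_fps1DX (R : comUnitRingType) : 1 + fpsX R \is a GRing.unit.
Proof. by rewrite fps_unitE fps_coefD addr0 unitr1. Qed.

Lemma fps_geometric (R : comUnitRingType) : 1 / (1 - fpsX R) = FPS (fun=> 1).
Proof.
apply: (mulrI (unit_fps1BX R)); rewrite mulrCA mulrV ?unit_fps1BX // mul1r.
apply: fpsP => n; rewrite mulrBl mul1r fps_coefD fps_coefN coef_fpsXM.
by case: n => [|n]; rewrite ?subr0 ?subrr.
Qed.

(** * Generating functions of chains by peaks *)

Section ChainSeries.

Variable R : comUnitRingType.
Variable d : nat -> bool.

Local Notation t := (fpsX R).
Local Notation u := (4 * t / (1 + t) ^+ 2).
Local Notation rho := ((1 + t) / (1 - t)).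

Definition chain_series (n : nat) : fps R := FPS (fun j => (chains d j.*2 n)%:R).

(** Alphabets of odd size are interleaved with those of even size, so that each step adds one letter
    and [chains_SK] applies. *)
Let low_series (n : nat) : fps R :=
  FPS (fun j => if j is j'.+1 then (chains d j'.*2.+1 n)%:R else 0).

Lemma chain_low_series1 :
  [/\ (1 - t) ^+ 2 * chain_series 1 = 2 * t
    & 2 * low_series 1 = (1 + t) * chain_series 1].
Proof.
set G := FPS (fun=> 1) : fps R.
have EG : (1 - t) * G = 1.
  by rewrite /G -fps_geometric mulrCA mulrV ?unit_fps1BX // mulr1.
have E1 : chain_series 1 = low_series 1 + t * G.
  apply: fpsP => -[|j]; rewrite fps_coefD coef_fpsXM /= ?addr0 //.
  by rewrite !chains1 doubleS -natr1.
have E2 : low_series 1 = t * chain_series 1 + t * G.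
  apply: fpsP => -[|j]; rewrite fps_coefD !coef_fpsXM /= ?addr0 //.
  by rewrite !chains1 -natr1.
have E3 : (1 - t) * chain_series 1 = 2 * (t * G) by rewrite mulrBl mul1r {1}E1 E2; ring.
split; last by rewrite {1}E2 mulrDr -E3; ring.
by rewrite expr2 -mulrA E3 mulrCA [(1 - t) * _]mulrCA EG mulr1.
Qed.

(** At an ascent only odd letters may be repeated, so for both new top letters [chains_SK] refers to
    an alphabet of even size and [low_series n.+1] drops out. *)
Let chain_series_asc n : d n ->
  [/\ (1 - t) * chain_series n.+2 = (1 + t) * chain_series n.+1
    & (1 + t) * low_series n.+2 = 2 * t * chain_series n.+2].
Proof.
move=> dn.
have E1 : chain_series n.+2 = low_series n.+2 + chain_series n.+1.
  apply: fpsP => -[|j]; rewrite fps_coefD /= ?addr0 //.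
  by rewrite doubleS chains_SK /= odd_double dn addn1 natrD.
have E2 : low_series n.+2 = t * chain_series n.+2 + t * chain_series n.+1.
  apply: fpsP => -[|j]; rewrite fps_coefD !coef_fpsXM /= ?addr0 //.
  by rewrite chains_SK /= odd_double dn addn0 natrD.
have E3 : (1 - t) * chain_series n.+2 = (1 + t) * chain_series n.+1.
  by rewrite mulrBl mul1r {1}E1 E2; ring.
split=> //; rewrite {1}E2 mulrDr mulrCA -[X in _ + X]mulrCA -E3; ring.
Qed.

(** Dually, only even letters may be repeated, and only alphabets of odd size remain. *)
Let chain_series_desc n : d n = false ->
  [/\ (1 - t) * chain_series n.+2 = 2 * low_series n.+1
    & 2 * low_series n.+2 = (1 + t) * chain_series n.+2].
Proof.
move=> dn.
have E1 : chain_series n.+2 = low_series n.+2 + low_series n.+1.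
  apply: fpsP => -[|j]; rewrite fps_coefD /= ?addr0 //.
  by rewrite doubleS chains_SK /= odd_double dn addn0 natrD.
have E2 : low_series n.+2 = t * chain_series n.+2 + low_series n.+1.
  apply: fpsP => -[|j]; rewrite fps_coefD !coef_fpsXM /= ?addr0 //.
  by rewrite chains_SK /= odd_double dn addn1 natrD.
have E3 : (1 - t) * chain_series n.+2 = 2 * low_series n.+1.
  by rewrite mulrBl mul1r {1}E1 E2; ring.
split=> //; rewrite {1}E2 mulrDr -E3; ring.
Qed.

Definition peaks n := count (fun r => d r && ~~ d r.+1) (iota 0 n).

Lemma peaksS n : peaks n.+1 = (peaks n + (d n && ~~ d n.+1))%N.
Proof. by rewrite /peaks -[X in iota 0 X]addn1 iotaD count_cat /= addn0. Qed.

(* The pair (chain_series, low_series) is in one of two projective states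
   according to the last comparison; only an ascent followed by a descent
   contributes the extra factor u. *)
Lemma chain_seriesE n :
  2 * chain_series n.+1 = rho ^+ n.+2 * u ^+ (peaks n.-1).+1.
Proof.
pose state n := if (0 < n)%N && d n.-1
  then (1 + t) * low_series n.+1 = 2 * t * chain_series n.+1
  else 2 * low_series n.+1 = (1 + t) * chain_series n.+1.
have U1 := unit_fps1BX R; have U2 := unit_fps1DX R.
have Erho : (1 - t) * rho = 1 + t by rewrite mulrC divrK.
have Eu : (1 + t) ^+ 2 * u = 4 * t by rewrite mulrC divrK ?unitrX.
suff: 2 * chain_series n.+1 = rho ^+ n.+2 * u ^+ (peaks n.-1).+1 /\ state n by case.
(* [rho] and [u] become variables subject to their defining equations, so that [ring] meets no
   inverses. *)
move: (rho) (u) Erho Eu => r v Er Ev.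
elim: n => [|n [IHP IHQ]].
  have [E1 E2] := chain_low_series1; split; last by rewrite /state.
  apply: (mulrI (unitrX 2 U1)); rewrite mulrCA E1 /peaks /=.
  have -> : (1 - t) ^+ 2 * (r ^+ 2 * v ^+ 1) = ((1 - t) * r) ^+ 2 * v by ring.
  by rewrite Er Ev; ring.
case dn: (d n).
  have [E1 E2] := chain_series_asc dn; split; last by rewrite /state /= dn.
  apply: (mulrI U1); rewrite mulrCA E1 mulrCA IHP.
  have -> : peaks n.+1.-1 = peaks n.-1.
    by case: (n) dn => // k dk; rewrite peaksS dk andbF addn0.
  by rewrite [r ^+ n.+3]exprS -Er; ring.
have [E1 E2] := chain_series_desc dn; split; last by rewrite /state /= dn.
case: n IHP IHQ dn E1 E2 => [|n] IHP; rewrite /state /=.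
  move=> IHQ _ E1 _.
  apply: (mulrI U1); rewrite mulrCA E1 IHQ mulrCA IHP [r ^+ 3]exprS -Er.
  by rewrite /peaks /=; ring.
case dn': (d n) => IHQ dn E1 _; rewrite peaksS dn' dn /= ?addn0 ?addn1.
  (* An ascent followed by a descent: the two transitions combine to a factor [4 * t], which is
     [(1 + t) ^+ 2 * v]. *)
  apply: (mulrI U1); apply: (mulrI U2).
  have -> : (1 + t) * ((1 - t) * (2 * chain_series n.+3))
      = 2 * (1 + t) * ((1 - t) * chain_series n.+3) by ring.
  rewrite E1.
  have -> : 2 * (1 + t) * (2 * low_series n.+2) = 4 * ((1 + t) * low_series n.+2) by ring.
  rewrite IHQ.
  have -> : 4 * (2 * t * chain_series n.+2) = 4 * t * (2 * chain_series n.+2) by ring.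
  rewrite IHP -Ev [r ^+ n.+4]exprS [v ^+ (_.+2)]exprS.
  have -> : (1 + t) ^+ 2 = (1 + t) * ((1 - t) * r) by rewrite Er expr2.
  by ring.
apply: (mulrI U1); rewrite mulrCA E1 IHQ mulrCA IHP [r ^+ n.+4]exprS -Er.
by ring.
Qed.

End ChainSeries.

(** * Standardization of words *)

Section Standardization.

Local Open Scope nat_scope.

Lemma perm_mkseq_iota n f g :
  (forall r, r < n -> f r < n) -> (forall r, r < n -> g r < n) ->
  (forall r, r < n -> g (f r) = r) -> (forall r, r < n -> f (g r) = r) ->
  perm_eq (mkseq f n) (iota 0 n).
Proof.
move=> fn gn fK gK; apply: uniq_perm; rewrite ?iota_uniq //.
  by apply/mkseq_uniqP => x y xn yn /(congr1 g); rewrite !fK.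
move=> k; rewrite mem_iota add0n; apply/mapP/idP => [[r]|ltkn].
  by rewrite mem_iota => ltrn ->; apply: fn; lia.
by exists (g k); rewrite ?gK // mem_iota gn.
Qed.

Lemma ltn_count (T : eqType) (a b : pred T) (s : seq T) x :
  {subset a <= b} -> x \in s -> b x -> ~~ a x -> count a s < count b s.
Proof.
move=> sub_ab + bx nax; elim: s => //= y s IHs; rewrite inE => /predU1P[<-|/IHs lt_s].
  by rewrite bx (negbTE nax) ltnS; apply: sub_count => z /sub_ab.
by have := sub_ab y; rewrite !unfold_in; case: (a y) => [->|_] //; lia.
Qed.

Lemma count_ltn_iota k n : k <= n -> count (fun q => q < k) (iota 0 n) = k.
Proof.
move=> le_kn; rewrite -(subnKC le_kn) iotaD count_cat add0n.
rewrite (@eq_in_count _ _ predT) ?count_predT ?size_iota => [|q].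
  rewrite (@eq_in_count _ _ pred0) ?count_pred0 ?addn0 // => q.
  by rewrite mem_iota /=; lia.
by rewrite mem_iota /=; lia.
Qed.

(** The pattern with positions counted from 0. Being an involution, it also lists the positions of
    the pattern by increasing letter. *)
Definition swap_pos (a q : nat) : nat :=
  if q == a.-1 then a else if q == a then a.-1 else q.

Lemma swap_pos_pred a : swap_pos a a.-1 = a.
Proof. by rewrite /swap_pos eqxx. Qed.

Lemma swap_pos_max a : 0 < a -> swap_pos a a = a.-1.
Proof. by move=> a0; rewrite /swap_pos eqxx; case: eqP. Qed.

Lemma swap_pos_id a q : q != a.-1 -> q != a -> swap_pos a q = q.
Proof. by rewrite /swap_pos => /negbTE -> /negbTE ->. Qed.

Lemma swap_posK a : 0 < a -> involutive (swap_pos a).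
Proof.
move=> a0 q; rewrite /swap_pos; case: (q =P a.-1) => [->|ne1]; last case: (q =P a) => [->|ne2].
- by rewrite eqxx; case: eqP; lia.
- by rewrite eqxx.
- by case: eqP => // _; case: eqP.
Qed.

Lemma swap_pos_lt m a q : 0 < a -> a < m -> q < m -> swap_pos a q < m.
Proof. by move=> a0 am qm; rewrite /swap_pos; do 2 case: ifP => // _; lia. Qed.

Lemma perm_swap_pos m a : 0 < a -> a < m -> perm_eq (mkseq (swap_pos a) m) (iota 0 m).
Proof.
move=> a0 am; apply: (@perm_mkseq_iota _ _ (swap_pos a)) => r ltr;
  by rewrite ?swap_posK ?swap_pos_lt.
Qed.

Lemma size_swap_pattern m a : 0 < a -> a < m -> size (swap_pattern m a) = m.
Proof. by move=> a0 am; rewrite /swap_pattern !size_cat !size_iota /=; lia. Qed.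

Lemma nth_swap_pattern m a q : 0 < a -> a < m -> q < m ->
  nth 0 (swap_pattern m a) q = (swap_pos a q).+1.
Proof.
move=> a0 am qm; rewrite /swap_pattern /swap_pos !nth_cat !size_iota /=.
case: ltnP => [lt1|ge1]; first by rewrite nth_iota //; do 2 (case: eqP; first by lia); lia.
case: (q =P a.-1) => [->|ne1]; first by rewrite subnn.
case: (q =P a) => [->|ne2]; first by rewrite (_ : a - a.-1 = 1) //=; lia.
by rewrite (_ : (q - a.-1 < 2) = false) ?nth_iota; lia.
Qed.

Lemma std_swap_pattern m a (x : seq nat) : 0 < a -> a < m -> size x = m -> uniq x ->
  (std x == swap_pattern m a) =
  all (fun q => nth 0 x (swap_pos a q) < nth 0 x (swap_pos a q.+1)) (iota 0 m.-1).
Proof.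
move=> a0 am szx uniqx.
have nth_std y : y < m -> nth 0 (std x) y = (count (fun z => z < nth 0 x y) x).+1.
  by move=> ltym; rewrite (nth_map 0) ?szx.
apply/eqP/allP => [std_x q|incr].
  rewrite mem_iota => ltq; have [lt0 lt1] : q < m /\ q.+1 < m by lia.
  have := nth_std _ (swap_pos_lt a0 am lt0); have := nth_std _ (swap_pos_lt a0 am lt1).
  rewrite std_x !nth_swap_pattern ?swap_pos_lt // !swap_posK // => -[E1] [E0].
  rewrite ltnNge; apply/negP => le_x.
  have : count (fun z => z < nth 0 x (swap_pos a q.+1)) x
      <= count (fun z => z < nth 0 x (swap_pos a q)) x by apply: sub_count => z /=; lia.
  by lia.
have mono : {in gtn m &, {mono (fun q => nth 0 x (swap_pos a q)) : p q / p < q}}.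
  have incr_lt p q : p < q -> q < m -> nth 0 x (swap_pos a p) < nth 0 x (swap_pos a q).
    elim: q => // q IHq; rewrite ltnS leq_eqVlt => /predU1P[->|lt_pq] ltqm.
      by apply: incr; rewrite mem_iota; lia.
    by apply: ltn_trans (IHq lt_pq _) (incr _ _); rewrite ?mem_iota; lia.
  move=> p q; rewrite !inE => ltp ltq; case: (ltngtP p q) => [lt_pq|lt_qp|->].
  - exact: incr_lt.
  - by have := incr_lt _ _ lt_qp ltp; lia.
  - by rewrite ltnn.
apply: (@eq_from_nth _ 0) => [|y]; first by rewrite size_map szx size_swap_pattern.
rewrite size_map szx => ltym; rewrite nth_std // nth_swap_pattern //; congr _.+1.
have ltk := swap_pos_lt a0 am ltym.
rewrite -{1}(swap_posK a0 y); move: (swap_pos a y) ltk => k ltk {ltym y}.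
(* The increasing reading rearranges [x], so its entry of index [k] has exactly [k] smaller
   letters. *)
have /seq.permP <- : perm_eq (mkseq (fun q => nth 0 x (swap_pos a q)) m) x.
  rewrite -[X in perm_eq _ X](mkseq_nth 0) szx /mkseq (map_comp (nth 0 x) (swap_pos a)).
  by apply: perm_map; apply: perm_swap_pos.
rewrite count_map -[RHS](count_ltn_iota (ltnW ltk)); apply: eq_in_count => q.
by rewrite mem_iota => ltq /=; rewrite mono // inE; lia.
Qed.

Definition inv_fun n (p : 'S_n) (r : nat) : nat :=
  if insub r is Some i then val ((p^-1)%g i) else r.

Lemma inv_fun_val n (p : 'S_n) (i : 'I_n) : inv_fun p i = (p^-1)%g i.
Proof. by rewrite /inv_fun valK. Qed.

Lemma perm_inv_fun n (p : 'S_n) : perm_eq (mkseq (inv_fun p) n) (iota 0 n).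
Proof.
have lt_inv (q : 'S_n) r : r < n -> inv_fun q r < n.
  by move=> ltr; rewrite (inv_fun_val q (Ordinal ltr)).
apply: (@perm_mkseq_iota _ _ (inv_fun p^-1)%g) => r ltr; try exact: lt_inv.
  by rewrite (inv_fun_val _ (Ordinal ltr)) inv_fun_val invgK permKV.
by rewrite (inv_fun_val _ (Ordinal ltr)) inv_fun_val invgK permK.
Qed.

Lemma sorts_inv_funP n (p : 'S_n) w :
  reflect (forall i k, (p i < p k) = pos_lt w i k) (sorts n (inv_fun p) w).
Proof.
apply: (iffP idP) => [sorted_w i k|H].
  have lt_imp x y : p x < p y -> pos_lt w x y.
    move=> lt_xy; have := sorts_lt sorted_w lt_xy (ltn_ord _).
    by rewrite !inv_fun_val !permK.
  case: (ltngtP (p i) (p k)) => [/lt_imp->//|/lt_imp/pos_lt_asym->//|].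
  by move=> /val_inj/perm_inj ->; rewrite pos_lt_irr.
apply/sortsP => r ltr.
have lt0 : r < n by lia.
by rewrite (inv_fun_val p (Ordinal lt0)) (inv_fun_val p (Ordinal ltr)) -H !permKV /=.
Qed.

Definition pos_rank (n : nat) (w : seq nat) (i : nat) : nat :=
  count (fun k => pos_lt w k i) (iota 0 n).

Lemma pos_rank_lt n w i k : i < n -> pos_lt w i k -> pos_rank n w i < pos_rank n w k.
Proof.
move=> ltin lt_ik; apply: (@ltn_count _ _ _ _ i) => [x||//|].
- by rewrite !unfold_in => /pos_lt_trans; apply.
- by rewrite mem_iota.
- by rewrite pos_lt_irr.
Qed.

(** The witness sends each position to its rank, injectively since the order is strict and total.
    Any sorting permutation preserves the order, so its values are these ranks. *)
Lemma sorts_unique n w :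
  exists p0 : 'S_n, forall p : 'S_n, sorts n (inv_fun p) w = (p == p0).
Proof.
have rank_lt (i : 'I_n) : pos_rank n w i < n.
  rewrite -[X in _ < X](size_iota 0 n) -count_predT.
  by apply: (@ltn_count _ _ _ _ (val i)); rewrite ?mem_iota ?pos_lt_irr ?ltn_ord.
have rank_mono (i k : 'I_n) : (pos_rank n w i < pos_rank n w k) = pos_lt w i k.
  apply/idP/idP => [lt_ik|]; last exact: pos_rank_lt.
  apply/negPn/negP => n_ik; have ne_ik : val i != val k.
    by apply: contraTneq lt_ik => ->; rewrite ltnn.
  have := pos_rank_lt (ltn_ord _) (pos_lt_total ne_ik n_ik).
  by move/(ltn_trans lt_ik); rewrite ltnn.
have rank_inj : injective (fun i => Ordinal (rank_lt i)).
  move=> i k [eq_ik]; apply/val_inj/eqP; apply/negPn/negP => ne_ik.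
  have := rank_mono i k; rewrite eq_ik ltnn => /esym/negbT/(pos_lt_total ne_ik).
  by rewrite -rank_mono eq_ik ltnn.
exists (perm rank_inj) => p; apply/sorts_inv_funP/eqP => [mono_p|-> i k]; last first.
  by rewrite !permE rank_mono.
apply/permP => i; rewrite permE; apply: val_inj => /=.
transitivity (count (fun q => q < p i) (iota 0 n)); first by rewrite count_ltn_iota // ltnW.
have /seq.permP <- := perm_inv_fun (p^-1)%g.
rewrite count_map; apply: eq_in_count => q; rewrite mem_iota add0n => ltq.
by rewrite /= (inv_fun_val _ (Ordinal ltq)) invgK mono_p.
Qed.

End Standardization.

(** * Occurrences of the pattern *)

Section OneLine.

Local Open Scope nat_scope.

Lemma nth_one_line n (p : 'S_n) (i : 'I_n) : nth 0 (one_line p) i = (p i).+1.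
Proof. by rewrite /one_line (nth_map i) ?size_enum_ord // nth_ord_enum. Qed.

Lemma size_one_line n (p : 'S_n) : size (one_line p) = n.
Proof. by rewrite size_map size_enum_ord. Qed.

Lemma uniq_one_line n (p : 'S_n) : uniq (one_line p).
Proof.
by rewrite map_inj_uniq ?enum_uniq // => i k [/val_inj/perm_inj].
Qed.

Lemma ipkE n (p : 'S_n) :
  ipk p = peaks (fun r => inv_fun p r < inv_fun p r.+1) (n - 2).
Proof.
(* [pk] indexes a peak by its middle, [peaks] by its left neighbour; hence the shift by 1. *)
rewrite /ipk /pk /peaks -[1]/(1 + 0) iotaDl count_map; apply: eq_in_count => r.
rewrite mem_iota => ltr; have [[lt0 lt1] lt2] : (r < n /\ r.+1 < n) /\ r.+2 < n by lia.
rewrite /= add1n /= (nth_one_line _ (Ordinal lt0)) (nth_one_line _ (Ordinal lt1)).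
rewrite (nth_one_line _ (Ordinal lt2)) !ltnS (inv_fun_val p (Ordinal lt0)).
rewrite (inv_fun_val p (Ordinal lt1)) (inv_fun_val p (Ordinal lt2)) -leqNgt.
congr (_ && _); rewrite [RHS]leq_eqVlt; case: eqP => // /val_inj/perm_inj/(congr1 val) /=.
by lia.
Qed.

End OneLine.

Section Occurrences.

Variables (m a : nat) (a_gt0 : (0 < a)%N) (a_ltm : (a < m)%N).
Local Open Scope nat_scope.

Definition occurs_at (w : seq nat) (p : nat) : bool :=
  (p + m <= size w) && sorts m (fun q => p + swap_pos a q) w.

Definition occ_from (w : seq nat) (p : nat) : nat :=
  count (occurs_at w) (iota p (size w - p)).

Lemma occ_fromS w p : p < size w -> occ_from w p = occurs_at w p + occ_from w p.+1.
Proof.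
by move=> ltp; rewrite /occ_from -(subnSK ltp).
Qed.

(** The letters of the standardization compare as [pos_lt] does, and occurrences depend only on
    these comparisons. *)
Lemma occ_sorts n (p : 'S_n) w : size w = n -> sorts n (inv_fun p) w ->
  occ (swap_pattern m a) p = occ_from w 0.
Proof.
move=> szw /sorts_inv_funP mono_p; rewrite /occ /occ_from size_swap_pattern // subn0 szw.
have -> : iota 0 n = iota 0 (n.+1 - m) ++ iota (n.+1 - m) (n - (n.+1 - m)).
  by rewrite -[X in iota X _ ++ _]add0n -[X in _ ++ iota X _]add0n -iotaD subnKC //; lia.
(* [occ_from] also scans the last positions, where the pattern no longer fits; they fail the length
   test. *)
rewrite count_cat [X in _ + X](@eq_in_count _ _ pred0) ?count_pred0 ?addn0; last first.
  move=> r; rewrite mem_iota /occurs_at szw => ltr.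
  by rewrite (_ : (r + m <= n) = false) //; lia.
apply: eq_in_count => j; rewrite mem_iota => ltj.
have le_j : j + m <= n by lia.
set x := take m (drop j (one_line p)).
have szx : size x = m by rewrite size_takel // size_drop size_one_line; lia.
have nth_x y : y < m -> exists2 i : 'I_n, val i = j + y & nth 0 x y = (p i).+1.
  move=> ltym; have lt_n : j + y < n by lia.
  by exists (Ordinal lt_n) => //; rewrite nth_take // nth_drop -nth_one_line.
rewrite std_swap_pattern //; last by rewrite take_uniq // drop_uniq // uniq_one_line.
rewrite /occurs_at szw le_j /sorts; apply: eq_in_all => q; rewrite mem_iota => ltq.
have [lt0 lt1] : q < m /\ q.+1 < m by lia.
have [i <- ->] := nth_x _ (swap_pos_lt a_gt0 a_ltm lt0).
have [k <- ->] := nth_x _ (swap_pos_lt a_gt0 a_ltm lt1).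
by rewrite ltnS mono_p.
Qed.

(** Words are grouped by their unique standardization, and [count_sorts] gives the size of each
    group. *)
Lemma sum_words_perm (R : comNzRingType) (s : R) K n :
  (\sum_(w <- words K n) s ^+ occ_from w 0 =
   \sum_(p : 'S_n) s ^+ occ (swap_pattern m a) p *+
     chains (fun r => inv_fun p r < inv_fun p r.+1)%N K n)%R.
Proof.
transitivity (\sum_(w <- words K n) \sum_(p : 'S_n)
    s ^+ occ (swap_pattern m a) p *+ sorts n (inv_fun p) w)%R.
  apply: eq_big_seq => w /size_word szw; have [p0 Ep0] := sorts_unique n w.
  rewrite (bigD1 p0) //= big1 ?addr0 => [|p ne_p]; last by rewrite Ep0 (negbTE ne_p).
  by rewrite Ep0 eqxx -(@occ_sorts _ p0) // Ep0.
rewrite exchange_big; apply: eq_bigr => p _ /=.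
rewrite sumrMnr -count_sorts ?perm_inv_fun // -sum1_count; congr (_ *+ _).
by rewrite [RHS]big_mkcond; apply: eq_bigr => w _; case: sorts.
Qed.

End Occurrences.

(** * Clusters *)

Section Clusters.

Variables m a : nat.
Local Open Scope nat_scope.

Local Notation ov := (minn a (m - a)).

(* Offsets of the marked occurrences, last one first: two occurrences
   overlap in at most min(a, m - a) letters. *)
Inductive cluster : seq nat -> Prop :=
| cluster_one : cluster [:: 0]
| cluster_cons g O : m - ov <= g < m -> cluster O -> cluster (head 0 O + g :: O).

Lemma cluster_head O : cluster O -> head 0 O \in O.
Proof. by case=> *; rewrite /= inE eqxx. Qed.

Lemma cluster_le O o : cluster O -> o \in O -> o <= head 0 O.
Proof.
elim=> [|g O' lt_g _ IHO]; rewrite inE; first by move/eqP=> ->.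
by case/predU1P => [->//|/IHO] /=; lia.
Qed.

Lemma cluster_gap O o o' : cluster O -> o \in O -> o' \in O -> o < o' -> o + (m - ov) <= o'.
Proof.
elim=> [|g O' lt_g clO' IHO]; rewrite !inE; first by move/eqP=> -> /eqP ->.
case/predU1P=> [->|oO] /predU1P[->|o'O]; rewrite ?ltnn //.
- by have := cluster_le clO' o'O; lia.
- by have := cluster_le clO' oO; lia.
- exact: IHO.
Qed.

(** Consecutive occurrences share at least one position, so no adjacent pair falls between two of
    them. *)
Lemma cluster_cover O r : cluster O -> r.+1 < head 0 O + m ->
  exists2 o, o \in O & o <= r /\ r.+1 < o + m.
Proof.
move=> clO; elim: clO r => [|g O' lt_g clO' IHO] r /=.
  by exists 0; rewrite ?inE //; lia.
move=> ltr; case: (ltnP r.+1 (head 0 O' + m)) => [/IHO[o oO lt_o]|ge_r].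
  by exists o; rewrite // inE oO orbT.
by exists (head 0 O' + g); rewrite ?inE ?eqxx //; lia.
Qed.

Hypotheses (a_ge2 : 2 <= a) (a_lem : a.+2 <= m) (m_ge5 : 5 <= m).

Lemma cluster_uniq O : cluster O -> uniq O.
Proof.
elim=> // g O' lt_g clO' IHO; rewrite /= IHO andbT.
by apply/negP => /(cluster_le clO'); lia.
Qed.

Definition cluster_perm (O : seq nat) (r : nat) : nat :=
  let S := map (addn^~ a) O in
  if r.+1 \in S then r.+1 else if r \in S then r.-1 else r.

Section OneCluster.

Variables (O : seq nat) (clO : cluster O).
Let S := map (addn^~ a) O.
Let N := head 0 O + m.
Local Notation tau := (cluster_perm O).

(** The overlap is at most half of [m] and [5 <= m], so offsets differ by at least 3. Each swapped
    pair is then flanked by fixed positions. *)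
Let S_gap x y : x \in S -> y \in S -> x < y -> x.+3 <= y.
Proof.
case/mapP => o oO -> /mapP[o' o'O ->] lt_o.
by have := cluster_gap clO oO o'O; lia.
Qed.

Let S_no x k : x \in S -> k.+1 < 3 -> (x + k.+1 \in S) = false.
Proof.
by move=> xS ltk; apply/negP => yS; have := S_gap xS yS; lia.
Qed.

Let S_lt x : x \in S -> 1 < x /\ x.+1 < N.
Proof.
by case/mapP => o oO ->; have := cluster_le clO oO; rewrite /N; lia.
Qed.

(** Another offset is at distance at least [m - min (a, m - a) = max (a, m - a)], which pushes its
    swapped position out of this range. *)
Let S_block o k : o \in O -> 0 < k < m -> (o + k \in S) = (k == a).
Proof.
move=> oO lt_k; apply/mapP/eqP => [[o' o'O eq_o]|->]; last by exists o.
by have := cluster_gap clO oO o'O; have := cluster_gap clO o'O oO; lia.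
Qed.

Let tau1 x : x.+1 \in S -> tau x = x.+1.
Proof. by rewrite /cluster_perm -/S => ->. Qed.

Let tau2 x : x \in S -> tau x = x.-1.
Proof.
by rewrite /cluster_perm -/S => xS; rewrite -addn1 S_no // xS.
Qed.

Let tau3 x : x \notin S -> x.+1 \notin S -> tau x = x.
Proof. by rewrite /cluster_perm -/S => /negbTE -> /negbTE ->. Qed.

Lemma cluster_permK : involutive tau.
Proof.
move=> r; case: (boolP (r.+1 \in S)) => [rS|nr1]; first by rewrite (tau1 rS) tau2.
case: (boolP (r \in S)) => [rS|nr]; last by rewrite !tau3.
by have [r1 _] := S_lt rS; rewrite (tau2 rS) tau1 prednK //; lia.
Qed.

Lemma cluster_perm_lt r : r < N -> tau r < N.
Proof.
move=> ltr; rewrite /cluster_perm -/S; case: ifP => [/S_lt|_]; first by lia.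
by case: ifP => _; lia.
Qed.

Lemma perm_cluster_perm : perm_eq (mkseq tau N) (iota 0 N).
Proof.
by apply: (@perm_mkseq_iota _ _ tau) => r; rewrite ?cluster_permK //; apply: cluster_perm_lt.
Qed.

(** The descents are isolated, one per swapped pair, and none is at the first step since [2 <= a];
    each closes exactly one peak. *)
Lemma peaks_cluster_perm : peaks (fun r => tau r < tau r.+1) (N - 2) = size O.
Proof.
rewrite -(size_map (addn^~ a) O) -/S /peaks.
have desc k : (tau k < tau k.+1) = (k.+1 \notin S).
  case: (boolP (k.+1 \in S)) => [kS|nk]; first by rewrite (tau1 kS) (tau2 kS) ltnNge leqnSn.
  have le_k : tau k <= k by rewrite /cluster_perm -/S (negbTE nk); case: ifP => _; lia.
  have : k.+1 <= tau k.+1 by rewrite /cluster_perm -/S (negbTE nk); case: ifP => _; lia.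
  by lia.
transitivity (count (fun x => x \in S) (iota 2 (N - 2))).
  rewrite -[2]/(2 + 0) iotaDl count_map; apply: eq_count => r /=.
  rewrite !desc negbK add2n; case: (boolP (r.+2 \in S)); rewrite ?andbF // andbT => rS.
  by apply/negP => rS'; have := S_gap rS' rS; lia.
rewrite -size_filter; apply: perm_size; apply: uniq_perm.
- by rewrite filter_uniq ?iota_uniq.
- by rewrite map_inj_uniq ?cluster_uniq // => x y; lia.
move=> x; rewrite mem_filter mem_iota; case: (boolP (x \in S)) => //= /S_lt.
by lia.
Qed.

Lemma cluster_sorts w : N <= size w -> all (occurs_at m a w) O = sorts N tau w.
Proof.
move=> leN; apply/allP/sortsP => [occ_w r ltr|sorted_w o oO].
  have lt_block o q : o \in O -> q.+1 < m ->
      pos_lt w (o + swap_pos a q) (o + swap_pos a q.+1).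
    by move=> /occ_w/andP[_ /sortsP]; apply.
  (* The comparisons touching a swapped pair: just before it, inside it, just after it. *)
  have near o : o \in O -> r.+2 = o + a \/ r.+1 = o + a \/ r = o + a ->
      pos_lt w (tau r) (tau r.+1).
    move=> oO; have aS : o + a \in S by apply/mapP; exists o.
    have nS k : k != o + a -> o + a <= k.+2 -> k <= (o + a).+2 -> k \notin S.
      move=> ne_k le1 le2; apply/negP => kS.
      have := S_gap kS aS; have := S_gap aS kS; move: ne_k le1 le2; clear; lia.
    have Epred : tau (o + a) = o + swap_pos a a.
      by rewrite tau2 // swap_pos_max //; move: a_ge2; clear; lia.
    case=> [Er|[Er|Er]].
    - have := lt_block o (a - 2) oO.
      rewrite (_ : (a - 2).+1 = a.-1) ?swap_pos_pred; last by lia.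
      rewrite swap_pos_id; try lia.
      rewrite (_ : o + (a - 2) = r); last by lia.
      have -> : tau r.+1 = o + a by rewrite tau1 Er.
      have -> : tau r = r by rewrite tau3 ?nS //; lia.
      by apply; lia.
    - have := lt_block o a.-1 oO; rewrite prednK ?swap_pos_pred; last by lia.
      have -> : tau r.+1 = o + swap_pos a a by rewrite Er Epred.
      have -> : tau r = o + a by rewrite tau1 Er.
      by apply; lia.
    - have := lt_block o a oO; rewrite -Epred [swap_pos a a.+1]swap_pos_id; try lia.
      have -> : tau r.+1 = o + a.+1 by rewrite tau3 ?nS; lia.
      by rewrite Er; apply; lia.
  case: (boolP (r.+2 \in S)) => [/mapP[o oO Er]|nr2]; first by apply: (near o); tauto.
  case: (boolP (r.+1 \in S)) => [/mapP[o oO Er]|nr1]; first by apply: (near o); tauto.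
  case: (boolP (r \in S)) => [/mapP[o oO Er]|nr]; first by apply: (near o); tauto.
  (* Away from the swaps both positions are fixed, and some marked occurrence contains the two. *)
  have [o oO [le_o lt_o]] := cluster_cover clO ltr.
  have ne_r k : k \notin S -> o + a != k by apply: contraNneq => <-; apply/mapP; exists o.
  have lt_q : (r - o).+1 < m by lia.
  have := lt_block _ _ oO lt_q; rewrite !tau3 // /swap_pos.
  have := ne_r _ nr2; have := ne_r _ nr1; have := ne_r _ nr.
  move=> n0 n1 n2; do 4 (case: eqP => [|_]; first by lia).
  by rewrite addnS subnKC.
have le_oN : o + m <= N by have := cluster_le clO oO; rewrite /N; lia.
rewrite /occurs_at (leq_trans le_oN leN); apply/sortsP => q ltq.
have a_gt0 : 0 < a by lia.
have a_ltm : a < m by lia.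
have lt0 : swap_pos a q < m - 1.
  by rewrite /swap_pos; case: eqP => [|_]; [lia|case: eqP => _; lia].
have lt1 : 0 < swap_pos a q.+1 < m.
  by rewrite /swap_pos; case: eqP => [|_]; [lia|case: eqP => _; lia].
(* On a block [tau] agrees with the local swap, except that the first position may move left and the
   last one right, into the swap of another occurrence. One-sided bounds suffice. *)
have tau_le k : k < m - 1 -> tau (o + k) <= o + swap_pos a k.
  move=> ltk; rewrite /cluster_perm -/S -addnS S_block //; last by lia.
  rewrite /swap_pos; case: eqP => [<-|ne_k]; first by rewrite eqxx.
  case: eqP => [|_]; first by lia.
  case: eqP => [->|ne_a]; last by case: ifP => _; lia.
  by rewrite S_block ?eqxx; lia.
have tau_ge k : 0 < k < m -> o + swap_pos a k <= tau (o + k).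
  move=> ltk; rewrite /cluster_perm -/S S_block // /swap_pos.
  case: (k =P a.-1) => [->|ne_k].
    by rewrite -addnS S_block ?prednK ?eqxx; lia.
  case: (k =P a) => [->|ne_a]; last by case: ifP => _; lia.
  by case: ifP => _; lia.
have := @sorts_lt N tau w (tau (o + swap_pos a q)) (tau (o + swap_pos a q.+1)).
rewrite !cluster_permK; apply; first exact/sortsP.
  have := tau_le _ lt0; have := tau_ge _ lt1; rewrite !swap_posK //.
  by lia.
by apply: cluster_perm_lt; lia.
Qed.

End OneCluster.

Lemma count_cluster K O : cluster O ->
  count (fun w => all (occurs_at m a w) O) (words K (head 0 O + m)) =
  chains (fun r => cluster_perm O r < cluster_perm O r.+1) K (head 0 O + m).
Proof.
move=> clO; rewrite -count_sorts ?perm_cluster_perm //.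
by apply: eq_in_count => w /size_word szw; rewrite cluster_sorts ?szw.
Qed.

(** The only descent of one occurrence would fall on an ascent of the other: for [g < a] the descent
    of the first lies in the second block, otherwise [g < m - a] and the descent of the second lies
    in the first block. *)
Lemma occurs_disjoint w p g : 0 < g < m - ov -> occurs_at m a w p ->
  occurs_at m a w (p + g) = false.
Proof.
move=> lt_g /andP[_ s1]; apply/negP => /andP[_ s2].
have a_gt0 : 0 < a by lia.
have lt_occ p' x y : sorts m (fun q => p' + swap_pos a q) w ->
    swap_pos a x < swap_pos a y -> swap_pos a y < m -> pos_lt w (p' + x) (p' + y).
  by move=> sp lt_xy lt_y; have := sorts_lt sp lt_xy lt_y; rewrite !swap_posK.
have desc p' : sorts m (fun q => p' + swap_pos a q) w -> pos_lt w (p' + a) (p' + a.-1).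
  move=> sp; apply: (lt_occ _ _ _ sp); rewrite swap_pos_pred ?swap_pos_max //; lia.
have asc p' x : sorts m (fun q => p' + swap_pos a q) w -> x.+1 < m -> x != a.-1 ->
    pos_lt w (p' + x) (p' + x.+1).
  move=> sp ltx ne_x; apply: (lt_occ _ _ _ sp); rewrite /swap_pos ?(negbTE ne_x);
    case: (x.+1 =P a.-1); case: (x.+1 =P a); case: (x =P a); lia.
have := desc _ s1; have := desc _ s2.
case: (ltnP g a) => [lt_ga|le_ag].
  have Ea : p + a = p + g + (a.-1 - g).+1 by lia.
  have Ea1 : p + a.-1 = p + g + (a.-1 - g) by lia.
  by move=> _; rewrite Ea Ea1 => /pos_lt_asym; rewrite asc //; lia.
have Ea : p + g + a = p + (g + a.-1).+1 by lia.
by rewrite Ea -addnA => /pos_lt_asym; rewrite asc //; lia.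
Qed.

End Clusters.

(** * The Goulden-Jackson recursion *)

Section ClusterSeries.

Variables (m a : nat) (a_ge2 : (2 <= a)%N) (a_lem : (a.+2 <= m)%N) (m_ge5 : (5 <= m)%N).
Variables (R : comNzRingType) (s : R).

Local Notation ov := (minn a (m - a)).
Local Notation occurs := (occurs_at m a).
Local Notation occs := (occ_from m a).

Lemma pos_lt_cat u v p q : pos_lt (u ++ v) (size u + p) (size u + q) = pos_lt v p q.
Proof.
rewrite /pos_lt ltn_add2l eqn_add2l !nth_cat.
by rewrite !(ltnNge (size u + _)) !leq_addr /= !addKn.
Qed.

Lemma occurs_cat u v p : occurs (u ++ v) (size u + p) = occurs v p.
Proof.
rewrite /occurs_at size_cat -addnA leq_add2l /sorts; congr (_ && _).
by apply: eq_all => r; rewrite -!addnA pos_lt_cat.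
Qed.

Lemma occurs_catl u v p : (p + m <= size u)%N -> occurs (u ++ v) p = occurs u p.
Proof.
move=> le_p; rewrite /occurs_at size_cat le_p (leq_trans le_p) ?leq_addr //.
apply: eq_in_all => r; rewrite mem_iota => ltr; rewrite /pos_lt !nth_cat.
have a_gt0 : (0 < a)%N by lia.
have a_ltm : (a < m)%N by lia.
have lt0 : (swap_pos a r < m)%N by apply: swap_pos_lt => //; lia.
have lt1 : (swap_pos a r.+1 < m)%N by apply: swap_pos_lt => //; lia.
by rewrite !(leq_trans _ le_p) // ltn_add2l.
Qed.

Lemma occs_cat u v : occs (u ++ v) (size u) = occs v 0.
Proof.
rewrite /occ_from size_cat addKn subn0 -[X in iota X]addn0 iotaDl count_map.
by apply: eq_count => p; rewrite /= occurs_cat.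
Qed.

(** Marking: the weight of an occurrence at [p] is split as [s = 1 + (s - 1)]. *)
Lemma expr_occs w p :
  s ^+ occs w p = s ^+ occs w p.+1 + (s - 1) * s ^+ occs w p.+1 *+ occurs w p.
Proof.
case: (ltnP p (size w)) => [ltp|lep].
  rewrite occ_fromS //; case: occurs; rewrite ?mulr0n ?addr0 // add1n exprS.
  by rewrite mulr1n; ring.
rewrite /occurs_at (_ : (p + m <= size w)%N = false) /=; last by lia.
have [E0 E1] : (size w - p = 0)%N /\ (size w - p.+1 = 0)%N by lia.
by rewrite /occ_from E0 E1 addr0.
Qed.

(** The summand at [g] is the case where the first marked occurrence is at [p + g]. *)
Lemma expr_occs_telescope w p k :
  s ^+ occs w p = s ^+ occs w (p + k) +
    (s - 1) * \sum_(0 <= g < k) s ^+ occs w (p + g).+1 *+ occurs w (p + g).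
Proof.
elim: k => [|k ->]; first by rewrite addn0 big_geq // mulr0 addr0.
by rewrite big_nat_recr //= mulrDr [s ^+ occs w (p + k)]expr_occs addnS mulrnAr; ring.
Qed.

Definition occ_series (K : nat) : fps R :=
  FPS (fun n => \sum_(w <- words K n) s ^+ occs w 0).

Definition marked_series (K : nat) (O : seq nat) : fps R :=
  FPS (fun n => \sum_(w <- words K n) s ^+ occs w (head 0%N O).+1 *+ all (occurs w) O).

(** If the occurrence at position 0 is not marked, the first letter is free and can be removed; the
    [1] is the empty word. *)
Lemma occ_series_rec K :
  occ_series K =
    1 + K%:R * (fpsX R * occ_series K) + fpsC (s - 1) * marked_series K [:: 0%N].
Proof.
apply: fpsP => n; rewrite !fps_coefD coef_fpsCM mulr_natl coef_fpsMn coef_fpsXM.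
rewrite fps_coef1 /=; under eq_bigr => w _ do rewrite expr_occs -mulrnAr.
rewrite big_split -big_distrr /=; congr (_ + _ * _); last first.
  by apply: eq_bigr => w _; rewrite andbT.
case: n => [|n]; first by rewrite big_seq1 mul0rn addr0.
rewrite add0r big_allpairs_dep (eq_bigr (fun=> occ_series K n)) => [|x _].
  by rewrite big_const_seq count_predT size_iota iter_addr_0.
by apply: eq_bigr => w _; rewrite -(occs_cat [:: x]).
Qed.

Lemma marked_series_low K O n : cluster m a O -> (n < head 0%N O + m)%N ->
  marked_series K O n = 0.
Proof.
move=> clO ltn; rewrite /= big1_seq // => w /= /size_word szw.
case: allP => // /(_ _ (cluster_head clO)) /andP[].
by rewrite szw leqNgt ltn.
Qed.

(** Either no later marked occurrence overlaps the last one, and an arbitrary word follows the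
    cluster, or the next one overlaps it in [l] letters and prolongs the cluster. *)
Lemma marked_series_rec K O : cluster m a O ->
  marked_series K O =
    (count (fun w => all (occurs w) O) (words K (head 0%N O + m)))%:R *
      (fpsX R ^+ (head 0%N O + m) * occ_series K)
    + fpsC (s - 1) * \sum_(1 <= l < ov.+1) marked_series K ((head 0%N O + (m - l))%N :: O).
Proof.
move=> clO; set L := head 0%N O; apply: fpsP => n.
rewrite fps_coefD coef_fpsCM mulr_natl coef_fpsMn coef_fpsXnM coef_fps_sum.
case: leqP => [le_n|lt_n]; last first.
  rewrite mul0rn add0r marked_series_low // big_nat big1 ?mulr0 // => l ltl.
  apply: marked_series_low; last by rewrite /= -/L; lia.
  by apply: cluster_cons => //; lia.
rewrite [LHS]/= -/L.
have telescope (w : seq nat) : s ^+ occs w L.+1 *+ all (occurs w) O =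
    s ^+ occs w (L + m) *+ all (occurs w) O
    + (s - 1) * \sum_(1 <= l < ov.+1)
        s ^+ occs w (L + (m - l)).+1 *+ all (occurs w) ((L + (m - l))%N :: O).
  case: (boolP (all _ O)) => [occO|]; last first.
    move=> nocc; rewrite !mulr0n add0r big1 ?mulr0 // => l _.
    by rewrite /= (negbTE nocc) andbF.
  have occL : occurs w L by apply: (allP occO); apply: (cluster_head clO).
  (* Exactly the [m - 1] starting positions after [L] give an overlap with the occurrence at [L]. *)
  rewrite (expr_occs_telescope _ _ m.-1) addSnnS prednK; last by lia.
  rewrite !mulr1n; congr (_ + _ * _).
  transitivity (\sum_(1 <= g < m) s ^+ occs w (L + g).+1 *+ occurs w (L + g)).
    rewrite -[1%N]add0n big_addn subn1; apply: eq_bigr => g _.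
    by rewrite addn1 addSnnS.
  (* Reindexing by the overlap [l = m - g]; larger overlaps are excluded by [occurs_disjoint]. *)
  rewrite big_nat_rev (@big_cat_nat _ _ _ ov.+1) /=; try lia.
  rewrite [X in _ + X]big_nat [X in _ + X]big1 ?addr0 => [|l ltl]; last first.
    by rewrite (occurs_disjoint a_ge2 a_lem m_ge5 _ occL) //; lia.
  by apply: eq_bigr => l _; rewrite add1n subSS occO andbT.
rewrite (eq_bigr _ (fun w _ => telescope w)) big_split -big_distrr /=.
congr (_ + _ * _); last by rewrite exchange_big.
rewrite -{1}(subnKC le_n) words_cat big_allpairs_dep -sum1_count -sumrMnr [RHS]big_mkcond.
apply: eq_big_seq => u /size_word szu; rewrite mulr1n.
have all_u v : all (occurs (u ++ v)) O = all (occurs u) O.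
  apply: eq_in_all => o /(cluster_le clO) le_o; apply: occurs_catl.
  by rewrite szu leq_add2r.
case: ifP => occ_u; last by rewrite big1 // => v _; rewrite all_u occ_u.
by apply: eq_bigr => v _; rewrite all_u occ_u -szu occs_cat.
Qed.

End ClusterSeries.

(** * Vanishing to high order and convergence *)

Lemma fps_lowM (R : comNzRingType) (c f : fps (fps R)) k :
  (forall j i, (i <= k)%N -> f j i = 0) -> forall j, (c * f) j k = 0.
Proof.
move=> f0 j; rewrite fps_coefM coef_fps_sum big1 // => j' _.
by rewrite fps_coefM big1 // => k' _; rewrite f0 ?mulr0 // leq_subr.
Qed.

Lemma fps_expr_low (R : comNzRingType) (f g : fps R) n k :
  f 0%N = 0 -> (k < n)%N -> (f ^+ n * g) k = 0.
Proof.
move=> f0 ltk; have -> : f = fpsX R * FPS (fun i => f i.+1).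
  by apply: fpsP => -[|i]; rewrite coef_fpsXM.
by rewrite exprMn -mulrA coef_fpsXnM leqNgt ltk.
Qed.

(** Multiplication by [c^-1] mixes outer degrees but never lowers the inner one, and the bound
    [k <= M] is uniform in [j]. *)
Lemma is_fps_sum_divl (R : comUnitRingType) (F : nat -> fps (fps R)) (c B : fps (fps R)) :
  c \is a GRing.unit ->
  (forall j k M, (k <= M)%N -> (\sum_(n < M) c * F n) j k = B j k) ->
  is_fps_sum F (c^-1 * B).
Proof.
move=> unit_c sumF j k; exists k => M le_kM.
have -> : \sum_(n < M) F n = c^-1 * B + c^-1 * (\sum_(n < M) c * F n - B).
  by rewrite -big_distrr mulrBr mulKr //= addrC subrK.
rewrite !fps_coefD (@fps_lowM _ _ (_ - _)) ?addr0 // => {}j i le_ik.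
by rewrite !fps_coefD !fps_coefN sumF ?subrr // (leq_trans le_ik).
Qed.

(** * Series in t and x *)

Section PeakSeries.

Variables m a : nat.
Hypotheses (a_ge2 : (2 <= a)%N) (a_lem : (a.+2 <= m)%N) (m_ge5 : (5 <= m)%N).
Variables (R : comUnitRingType) (s : R).
Hypothesis unit2 : (2 : R) \is a GRing.unit.

Local Notation T := (fps (fps R)).
Local Notation ov := (minn a (m - a)).
Local Notation t := (fpsX (fps R) : T).
Local Notation x := (fpsC (fpsX R) : T).
Local Notation u := (4 * t / (1 + t) ^+ 2).
Local Notation rho := ((1 + t) / (1 - t)).
Local Notation z := ((1 + t) * x / (1 - t)).
Local Notation c := ((1 + t) / (2 * (1 - t))).
Local Notation A j := (occ_series m a s j.*2).

Lemma unit2_fps : (2 : T) \is a GRing.unit.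
Proof. by rewrite !fps_unitE. Qed.

Lemma unit_half : 2 * (1 - t) \is a GRing.unit.
Proof. by rewrite unitrM unit2_fps unit_fps1BX. Qed.

Lemma zE : z = rho * x.
Proof. by rewrite mulrAC. Qed.

Lemma cE : 2 * c = rho.
Proof.
apply: (mulrI unit_half); rewrite mulrCA [_ * (_ / _)]mulrC divrK ?unit_half //.
by rewrite -mulrA [_ * (_ / _)]mulrC divrK ?unit_fps1BX.
Qed.

(** [c] is half of [rho] and each [z] is [rho * x], which yields the power of [rho] in
    [chain_seriesE]. *)
Lemma half_peak_series (d : nat -> bool) n :
  c * u ^+ (peaks d n.-1).+1 * z ^+ n.+1 = chain_series (fps R) d n.+1 * x ^+ n.+1.
Proof.
have gen (two cc r uu xx S : T) N : two * cc = r -> two * S = r ^+ N.+1 * uu ->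
    two * (cc * uu * (r * xx) ^+ N) = two * (S * xx ^+ N).
  move=> <- E; rewrite [RHS]mulrA E exprS exprMn -!mulrA; congr (_ * (_ * _)).
  by rewrite [RHS]mulrCA.
by apply: (mulrI unit2_fps); rewrite zE; apply: gen; [apply: cE|apply: chain_seriesE].
Qed.

Lemma coef_half_peak_series (d : nat -> bool) n j :
  (c * u ^+ (peaks d n.-1).+1 * z ^+ n.+1) j
  = (chains d j.*2 n.+1)%:R * fpsX R ^+ n.+1.
Proof. by rewrite half_peak_series -fpsCX mulrC coef_fpsCM mulrC. Qed.

(** [half_peak_series] turns the weight of a permutation into the number of words over [2 * j]
    letters that standardize to it; [sum_words_perm] collects them. *)
Lemma coef_P_ipk n j k :
  (c * (P_ipk (swap_pattern m a) n.+1 (fpsC (fpsC s)) u * z ^+ n.+1)) j k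
  = if k == n.+1 then A j k else 0.
Proof.
have a_gt0 : (0 < a)%N by lia.
have a_ltm : (a < m)%N by lia.
rewrite /P_ipk big_distrl big_distrr /= 2!coef_fps_sum.
transitivity (\sum_(p : 'S_n.+1) if k == n.+1 then s ^+ occ (swap_pattern m a) p *+
     chains (fun r => inv_fun p r < inv_fun p r.+1)%N j.*2 n.+1 else 0).
  have swap (C S U Z : T) : C * (S * U * Z) = S * (C * U * Z).
    by rewrite -(mulrA S) (mulrCA C) (mulrA C).
  apply: eq_bigr => p _; rewrite swap ipkE subSS subn1.
  rewrite -2!fpsCX coef_fpsCM coef_half_peak_series coef_fpsCM mulr_natl coef_fpsMn.
  rewrite -[fpsX R ^+ _]mulr1 coef_fpsXnM fps_coef1.
  case: (ltngtP k n.+1) => [||->]; rewrite ?mul0rn ?mulr0 ?subnn ?mulr_natr //.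
  by rewrite -subn_gt0; case: (k - _)%N; rewrite ?mul0rn ?mulr0.
case: eqP => [->|_]; last by rewrite big1.
by rewrite -sum_words_perm.
Qed.

Definition cluster_den : T := 1 - fpsC (fpsC (s - 1)) * u * \sum_(1 <= l < ov.+1) z ^+ (m - l).

(** All prolongations of a cluster with [k] occurrences and [N] letters: each further occurrence
    contributes a factor [(s - 1) * u * z ^ (m - l)], and the quotient sums the geometric series. *)
Definition cluster_tail k N : T := c * u ^+ k.+1 * z ^+ N / cluster_den.

Lemma unit_cluster_den : cluster_den \is a GRing.unit.
Proof.
rewrite !fps_unitE /cluster_den fps_coefD fps_coefN.
have -> : fpsC (fpsC (s - 1)) * u * (\sum_(1 <= l < ov.+1) z ^+ (m - l)) =
   t * (fpsC (fpsC (s - 1)) * (4 / (1 + t) ^+ 2) * (\sum_(1 <= l < ov.+1) z ^+ (m - l))).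
  by rewrite [4 * t]mulrC -[t * 4 / _]mulrA !(mulrCA _ t) !mulrA.
by rewrite coef_fpsXM subr0 unitr1.
Qed.

Lemma cluster_tail_rec k N :
  cluster_tail k N = c * u ^+ k.+1 * z ^+ N +
    fpsC (fpsC (s - 1)) * \sum_(1 <= l < ov.+1) cluster_tail k.+1 (N + (m - l)).
Proof.
have gen (C U Z D V S : T) (F : nat -> T) : D \is a GRing.unit ->
    D = 1 - S * U * \sum_(1 <= l < ov.+1) F l ->
    C * V * Z / D = C * V * Z + S * \sum_(1 <= l < ov.+1) (C * (U * V) * (Z * F l) / D).
  move=> unitD eD; apply: (mulIr unitD); rewrite divrK // mulrDl -(mulrA S) big_distrl /=.
  rewrite (eq_bigr (fun l => C * (U * V) * Z * F l)) => [|l _]; last by rewrite divrK // mulrA.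
  by rewrite -big_distrr /= eD; ring.
rewrite /cluster_tail (gen _ u _ _ _ _ _ unit_cluster_den erefl); congr (_ + _ * _).
by apply: eq_bigr => l _; rewrite -exprS -exprD.
Qed.

Lemma coef_cluster_tail_low (f : fps R) k N j n : (n < N)%N ->
  (f * cluster_tail k N j) n = 0.
Proof.
have swap (C U V X D : T) : C * U * (V * X) / D = X * (C * U * V / D).
  by rewrite (mulrA (C * U)) (mulrC _ X) -(mulrA X).
move=> ltn; rewrite /cluster_tail zE [(rho * x) ^+ N]exprMn swap -fpsCX coef_fpsCM.
by rewrite mulrCA coef_fpsXnM leqNgt ltn.
Qed.

Lemma coef_cluster_tail_rec k N j :
  cluster_tail k N j = (c * u ^+ k.+1 * z ^+ N) j +
    fpsC (s - 1) * \sum_(1 <= l < ov.+1) cluster_tail k.+1 (N + (m - l)) j.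
Proof. by rewrite {1}cluster_tail_rec fps_coefD coef_fpsCM coef_fps_sum. Qed.

(** Both sides satisfy the same recursion and vanish in degrees below the length of the cluster.
    Prolonging lengthens the cluster, so induction on the excess [e] of the degree over that length
    applies. *)
Lemma marked_seriesE O j : cluster m a O ->
  marked_series m a s j.*2 O = A j * cluster_tail (size O) (head 0%N O + m) j.
Proof.
move=> clO; apply: fpsP => n.
have [e] : exists e, (n < head 0%N O + m + e)%N by exists n.+1; lia.
elim: e O clO => [|e IHe] O clO ltn.
  by rewrite addn0 in ltn; rewrite coef_cluster_tail_low // marked_series_low.
have N_gt0 : (0 < head 0%N O + m)%N by lia.
have := coef_half_peak_series (fun r => cluster_perm a O r < cluster_perm a O r.+1)%N
  (head 0 O + m).-1 j.
rewrite prednK // -subn2 peaks_cluster_perm // => Ecoef.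
rewrite marked_series_rec // count_cluster // coef_cluster_tail_rec Ecoef mulrDr !fps_coefD.
congr (_ + _); first by rewrite mulrA [in LHS]mulrC.
rewrite (mulrCA (A j)) !coef_fpsCM; congr (_ * _); rewrite big_distrr /= !coef_fps_sum.
apply: eq_big_nat => l ltl; rewrite IHe /=; first by rewrite addnAC.
  by apply: cluster_cons => //; lia.
by lia.
Qed.

Lemma chain_series1E (d : nat -> bool) :
  chain_series (fps R) d 1 = 2 * t / (1 - t) ^+ 2.
Proof.
have [E _] := chain_low_series1 (fps R) d.
by rewrite -E mulrC mulKr // unitrX // unit_fps1BX.
Qed.

(** On the coefficient of [t ^ j] a Hadamard power is an ordinary power of [F j], so the partial sum
    differs from [S] by [F j ^+ M * S], of order at least [M]. *)
Lemma geometric_coef (F : T) (S : fps R) j M k : (k < M)%N ->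
  F j 0%N = 0 -> S = 1 + F j * S -> (\sum_(n < M) hadamard_exp F n) j k = S k.
Proof.
move=> ltkM F0 ES; rewrite coef_fps_sum.
have hexp n : hadamard_exp F n j = F j ^+ n.
  elim: n => [|n IHn]; last by rewrite exprS -IHn.
  by rewrite -[LHS]/((1 / (1 - t) : T) j) fps_geometric.
under eq_bigr => n _ do rewrite hexp.
have -> : \sum_(n < M) F j ^+ n = S - F j ^+ M * S.
  have ES1 : (1 - F j) * S = 1 by rewrite mulrBl mul1r {1}ES addrK.
  rewrite -[LHS]mul1r -ES1 mulrAC -[1 - F j]opprB [- _ * _]mulNr -subrX1; ring.
by rewrite fps_coefD fps_coefN fps_expr_low // subr0.
Qed.

Lemma cluster_tail1E (s1 := fpsC (fpsC (s - 1))) :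
  (1 + t) * s1 * u ^+ 2 * z ^+ m
    / (2 * (1 - t) * (1 - s1 * u * \sum_(1 <= l < ov.+1) z ^+ (m - l)))
  = s1 * cluster_tail 1 m.
Proof.
rewrite -/cluster_den /cluster_tail (invrM unit_half unit_cluster_den).
move: (1 + t) s1 (u ^+ 2) (z ^+ m) (2 * (1 - t))^-1 cluster_den^-1 => p s1 U Z D Y.
by ring.
Qed.

(** [s0] and [s1] are separate variables so that the result applies both to an indeterminate [s] and
    to [s = 0]. *)
Lemma inverse_peak_cluster_identity (s0 s1 : T) :
  s0 = fpsC (fpsC s) -> s1 = fpsC (fpsC (s - 1)) ->
  exists L S : T,
    [/\ is_fps_sum (fun n => P_ipk (swap_pattern m a) n.+1 s0 u * z ^+ n.+1) L,
        is_fps_sum (fun n => hadamard_exp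
          (2 * t * x / (1 - t) ^+ 2
           + (1 + t) * s1 * u ^+ 2 * z ^+ m
             / (2 * (1 - t) * (1 - s1 * u * \sum_(1 <= l < ov.+1) z ^+ (m - l)))) n) S
      & 1 / (1 - t) + c * L = S].
Proof.
move=> -> ->; rewrite cluster_tail1E.
have unit_c : c \is a GRing.unit by rewrite unitrM unitrV unit_half unit_fps1DX.
pose S : T := FPS (fun j => A j).
pose B := S - 1 / (1 - t).
exists (c^-1 * B), S; split; last by rewrite mulVKr // /B addrC subrK.
  apply: is_fps_sum_divl => // j k M le_kM.
  rewrite 2!coef_fps_sum.
  rewrite (eq_bigr (fun n : 'I_M => if k == n.+1 then A j k else 0)); last first.
    by move=> n _; rewrite coef_P_ipk.
  rewrite /B fps_geometric !fps_coefD !fps_coefN.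
  case: k le_kM => [|k] lt_kM.
    (* In degree 0 the empty word cancels against [1 / (1 - t)]. *)
    by rewrite [LHS]big1 //= /occ_from /= big_seq1 expr0 subrr.
  rewrite subr0 (bigD1 (Ordinal lt_kM)) //= eqxx [X in _ + X]big1 ?addr0 // => n.
  by rewrite eqSS -val_eqE eq_sym /= => /negbTE ->.
move=> j k; exists k.+1 => M lt_kM.
have coefF : (2 * t * x / (1 - t) ^+ 2 + fpsC (fpsC (s - 1)) * cluster_tail 1 m) j =
    fpsX R * j.*2%:R + fpsC (s - 1) * cluster_tail 1 m j.
  rewrite fps_coefD mulrAC -(chain_series1E xpredT) [chain_series _ _ _ * _]mulrC.
  by rewrite !coef_fpsCM /= chains1.
apply: geometric_coef => //; rewrite coefF.
  rewrite fps_coefD coef_fpsXM coef_fpsCM add0r -[cluster_tail 1 m j]mul1r.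
  by rewrite coef_cluster_tail_low ?mulr0 //; lia.
(* The Goulden-Jackson equation, with the marked words expressed through the cluster series. *)
rewrite -[S j]/(A j) [LHS](occ_series_rec a_ge2 a_lem m_ge5).
rewrite marked_seriesE; last exact: cluster_one.
by rewrite [head _ _]/= add0n; ring.
Qed.

End PeakSeries.

(** * The case [s = 0] and the conclusion *)

Lemma inverse_peak_avoidance_identity (m a : nat) (R : comUnitRingType) :
  (2 <= a)%N -> (a.+2 <= m)%N -> (5 <= m)%N -> (2 : R) \is a GRing.unit ->
  let t : fps (fps R) := fpsX _ in
  let x : fps (fps R) := fpsC (fpsX _) in
  let u := 4 * t / (1 + t) ^+ 2 in
  let z := (1 + t) * x / (1 - t) in
  exists L S : fps (fps R),
    [/\ is_fps_sum (fun n => P_ipk (swap_pattern m a) n.+1 0 u * z ^+ n.+1) L,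
        is_fps_sum (fun n => hadamard_exp
          (2 * t * x / (1 - t) ^+ 2
           - (1 + t) * u ^+ 2 * z ^+ m
             / (2 * (1 - t) * (1 + u * \sum_(1 <= l < (minn a (m - a)).+1) z ^+ (m - l)))) n) S
      & 1 / (1 - t) + (1 + t) / (2 * (1 - t)) * L = S].
Proof.
move=> a_ge2 a_lem m_ge5 unit2 t x u z.
(* At [s = 0] the marking weight is -1, which changes both signs. *)
have neg (T : comUnitRingType) (p U Z D v V : T) :
    p * -1 * U * Z / (D * (1 - -1 * v * V)) = - (p * U * Z / (D * (1 + v * V))).
  by rewrite mulrN1 !mulN1r !mulNr opprK.
have [| |L [S]] := inverse_peak_cluster_identity
  a_ge2 a_lem m_ge5 (s := 0) unit2 (s0 := 0) (s1 := -1).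
- by rewrite !fpsC0.
- by rewrite sub0r !fpsCN.
by rewrite neg => identity; exists L, S.
Qed.

Theorem theorem5p3 (m a : nat) :
  (5 <= m)%N -> (2 <= a)%N -> (a <= m - 2)%N ->
  let sigma := swap_pattern m a in
  let i := minn a (m - a) in
  let t : fps (fps {poly rat}) := fpsX _ in
  let x : fps (fps {poly rat}) := fpsC (fpsX _) in
  let s : fps (fps {poly rat}) := fpsC (fpsC 'X) in
  let u := 4 * t / (1 + t) ^+ 2 in
  let z := (1 + t) * x / (1 - t) in
  (exists L R : fps (fps {poly rat}),
    [/\ is_fps_sum (fun n => P_ipk sigma n.+1 s u * z ^+ n.+1) L,
        is_fps_sum
          (fun n => hadamard_exp
             (2 * t * x / (1 - t) ^+ 2
              + (1 + t) * (s - 1) * u ^+ 2 * z ^+ m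
                / (2 * (1 - t)
                   * (1 - (s - 1) * u * \sum_(1 <= l < i.+1) z ^+ (m - l))))
             n) R
      & 1 / (1 - t) + (1 + t) / (2 * (1 - t)) * L = R])
  /\
  (exists L R : fps (fps {poly rat}),
    [/\ is_fps_sum (fun n => P_ipk sigma n.+1 0 u * z ^+ n.+1) L,
        is_fps_sum
          (fun n => hadamard_exp
             (2 * t * x / (1 - t) ^+ 2
              - (1 + t) * u ^+ 2 * z ^+ m
                / (2 * (1 - t)
                   * (1 + u * \sum_(1 <= l < i.+1) z ^+ (m - l))))
             n) R
      & 1 / (1 - t) + (1 + t) / (2 * (1 - t)) * L = R]).
Proof.
move=> m_ge5 a_ge2 a_le /=.
have a_lem : (a.+2 <= m)%N by lia.
have unit2 : (2 : {poly rat}) \is a GRing.unit.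
  by rewrite -[2]polyC_natr; apply: rmorph_unit.
split; last exact: inverse_peak_avoidance_identity.
apply: (inverse_peak_cluster_identity a_ge2 a_lem m_ge5 (s := 'X) unit2) => //.
by rewrite fpsCD fpsCN fpsCD fpsCN.
Qed.
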